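(* Let $n$ be a positive integer, let $Y$ be a compact Hausdorff space, and let $Y_1\subseteq Y$ be a closed subset. Let $\sim$ be the equivalence relation on $X_n\times Y$ gluing the $n$ copies of $Y$ along $Y_1$, and let $\widetilde{\alpha}: C((X_n\times Y)/\sim)\to C((X_n\times Y)/\sim)\otimes A_n$ be the action of the quantum permutation group $A_n$ on $(X_n\times Y)/\sim$ obtained by restricting $\alpha$ (all defined in the context). If $Y_1\neq Y$, then the action $\widetilde{\alpha}$ is faithful.
   Context: Tensor products of unital C*-algebras are minimal. For a $*$-homomorphism $\beta:B\to B\otimes A$, $\beta(B)(1\otimes A)$ denotes the linear span of $\{\beta(b)(1_B\otimes a): b\in B, a\in A\}$ and $\beta(B)(B\otimes 1)$ the linear span of $\{\beta(b_1)(b_2\otimes 1_A): b_1,b_2\in B\}$. A compact quantum group is a unital C*-algebra $A$ with a unital $*$-homomorphism $\Delta:A\to A\otimes A$ such that $(\Delta\otimes id)\Delta=(id\otimes\Delta)\Delta$ and both $\Delta(A)(1\otimes A)$ and $\Delta(A)(A\otimes 1)$ are dense in $A\otimes A$. A compact quantum quotient group of $(A,\Delta)$ is a unital C*-subalgebra $Q\subseteq A$ with $\Delta(Q)\subseteq Q\otimes Q$ and with $\Delta(Q)(1\otimes Q)$ and $\Delta(Q)(Q\otimes 1)$ dense in $Q\otimes Q$; it is proper if $Q\neq A$. An action of $(A,\Delta)$ on a unital C*-algebra $B$ is a unital $*$-homomorphism $\alpha:B\to B\otimes A$ with $(\alpha\otimes id)\alpha=(id\otimes\Delta)\alpha$ and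 $\alpha(B)(1\otimes A)$ dense in $B\otimes A$. An action on a compact Hausdorff space $X$ means an action on $C(X)$, the C*-algebra of continuous complex-valued functions on $X$. The action $\alpha$ is faithful if there is no proper compact quantum quotient group $Q$ of $A$ such that $\alpha$ induces an action $\alpha_q$ of $Q$ on $B$ with $\alpha(b)=\alpha_q(b)$ for all $b\in B$. Quantum permutation group: $A_n$ is the universal C*-algebra generated by $a_{ij}$ ($1\le i,j\le n$) with relations $a_{ij}^*=a_{ij}=a_{ij}^2$ and $\sum_{i=1}^n a_{ij}=\sum_{j=1}^n a_{ij}=1$, with comultiplication $\Delta_n(a_{ij})=\sum_{k=1}^n a_{ik}\otimes a_{kj}$; $(A_n,\Delta_n)$ is a compact quantum group. $X_n=\{x_1,\dots,x_n\}$ is the discrete space with $n$ points, and $e_i\in C(X_n)$ is given by $e_i(x_j)=\delta_{ij}$. Identify $C(X_n\times Y)=C(X_n)\otimes C(Y)$. The action $\alpha$ of $A_n$ on $X_n\times Y$ is the one given by $\alpha(e_i\otimes f)=\sum_{k=1}^n e_k\otimes f\otimes a_{ki}$ for $1\le i\le n$, $f\in C(Y)$. Equivalence relation: $(x',y')\sim(x'',y'')$ iff either $y'=y''\in Y_1$, or $y'=y''$ and $x'=x''$. The quotient $(X_n\times Y)/\sim$ is compact Hausdorff, and $C((X_n\times Y)/\sim)$ is regarded as the C*-subalgebra of $C(X_n\times Y)$ of functions constant on equivalence classes. The restriction of $\alpha$ to $C((X_n\times Y)/\sim)$ takes values in $C((X_n\times Y)/\sim)\otimes A_n$ and is an action of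 $A_n$, denoted $\widetilde{\alpha}$. *)

(* Defs.v *)
From HB Require Import structures.
From mathcomp Require Import all_boot all_order all_algebra.
From mathcomp Require Import all_classical all_reals all_analysis.
From mathcomp.real_closed Require Import complex.
Set Implicit Arguments. Unset Strict Implicit. Unset Printing Implicit Defensive.
Import Order.TTheory GRing.Theory Num.Theory.
Import numFieldNormedType.Exports.
Local Open Scope classical_set_scope.
Local Open Scope ring_scope.
Local Open Scope complex_scope.

(* The product and the unit are fields of the mixin: a structure joining
   GRing.PzRing with a normed Z-module is refused by Hierarchy Builder, whose
   only join of the two is Num.NumDomain.  The zero algebra is allowed. *)
HB.mixin Record isCstarAlgebra (R : realType) A
    of CompleteNormedModule R[i] A := {
  cmul : A -> A -> A;
  cone : A;
  star : A -> A;
  cmulA : associative cmul;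
  cmul1l : left_id cone cmul;
  cmul1r : right_id cone cmul;
  cmulDl : left_distributive cmul +%R;
  cmulDr : right_distributive cmul +%R;
  cmulZl : forall (c : R[i]) x y, cmul (c *: x) y = c *: cmul x y;
  cmulZr : forall (c : R[i]) x y, cmul x (c *: y) = c *: cmul x y;
  starD : {morph star : x y / x + y};
  starZ : forall (c : R[i]) x, star (c *: x) = c^* *: star x;
  starM : forall x y, star (cmul x y) = cmul (star y) (star x);
  starK : involutive star;
  cnormM : forall x y, `|cmul x y| <= `|x| * `|y|;
  cnorm_star : forall x, `|cmul (star x) x| = `|x| ^+ 2
}.

#[short(type="cstarType")]
HB.structure Definition CstarAlgebra (R : realType) :=
  {A of isCstarAlgebra R A & CompleteNormedModule R[i] A}.

Infix "**" := cmul (at level 40, left associativity) : ring_scope.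

HB.mixin Record isHilbert (R : realType) H of CompleteNormedModule R[i] H := {
  dot : H -> H -> R[i];
  dotDl : forall x y z, dot (x + y) z = dot x z + dot y z;
  dotZl : forall (c : R[i]) x y, dot (c *: x) y = c * dot x y;
  dotC : forall x y, dot y x = (dot x y)^*;
  dot_norm : forall x, dot x x = `|x| ^+ 2
}.

#[short(type="hilbertType")]
HB.structure Definition Hilbert (R : realType) :=
  {H of isHilbert R H & CompleteNormedModule R[i] H}.

Definition lspan (R : realType) (V : completeNormedModType R[i]) (S : set V) :
    set V :=
  [set v | exists (n : nat) (c : 'I_n -> R[i]) (x : 'I_n -> V),
     (forall i, S (x i)) /\ v = \sum_i c i *: x i].

Definition closed_span (R : realType) (V : completeNormedModType R[i])
  (S : set V) : set V := closure (lspan S).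

Section CstarNotions.
Variable R : realType.

Record cstar_subalgebra (A : cstarType R) (S : set A) : Prop := {
  csub_closed : closed S;
  csub1 : S (cone : A);
  csub_lin : forall (c : R[i]) x y, S x -> S y -> S (c *: x + y);
  csubM : forall x y, S x -> S y -> S (x ** y);
  csub_star : forall x, S x -> S (star x)
}.

(* Unital *-homomorphism on a C*-subalgebra S; values outside S are junk. *)
Record star_hom_on (A B : cstarType R) (S : set A) (f : A -> B) : Prop := {
  shom1 : f cone = cone;
  shom_lin : forall (c : R[i]) x y, S x -> S y -> f (c *: x + y) = c *: f x + f y;
  shomM : forall x y, S x -> S y -> f (x ** y) = f x ** f y;
  shom_star : forall x, S x -> f (star x) = star (f x)
}.

Definition star_hom (A B : cstarType R) (f : A -> B) := star_hom_on setT f.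

Definition is_opnorm (H : hilbertType R) (T : H -> H) (M : R[i]) : Prop :=
  [/\ 0 <= M, (forall v, `|T v| <= M * `|v|)
    & forall M', 0 <= M' -> (forall v, `|T v| <= M' * `|v|) -> M <= M'].

(* Isometric unital *-representation, that is, an identification of A with a
   C*-algebra of operators on H (for C*-algebras: a faithful representation). *)
Record is_faithful_rep (A : cstarType R) (H : hilbertType R)
    (p : A -> H -> H) : Prop := {
  rep_linv : forall a, linear (p a);
  rep_lin : forall v, linear (p^~ v);
  rep1 : forall v, p cone v = v;
  repM : forall a b v, p (a ** b) v = p a (p b v);
  rep_star : forall a v w, dot (p (star a) v) w = dot v (p a w);
  rep_norm : forall a, is_opnorm (p a) `|a|
}.

Record is_hilbert_tensor (H K HK : hilbertType R) (h : H -> K -> HK) : Prop := {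
  hten_linl : forall w, linear (h^~ w);
  hten_linr : forall v, linear (h v);
  hten_dot : forall v w v' w', dot (h v w) (h v' w') = dot v v' * dot w w';
  hten_dense : closed_span [set h v w | v in setT & w in setT] = setT
}.

(* T, with t a b standing for the elementary tensor of a and b, is the minimal
   (spatial) tensor product: the closure of the span of the operators
   p a (x) q b in B(H (x) K), for A in B(H) via p and B in B(K) via q. *)
Record is_min_tensor (A B T : cstarType R) (t : A -> B -> T) : Prop := {
  mten_linl : forall b, linear (t^~ b);
  mten_linr : forall a, linear (t a);
  mten1 : t cone cone = cone;
  mtenM : forall a b a' b', t (a ** a') (b ** b') = t a b ** t a' b';
  mten_star : forall a b, t (star a) (star b) = star (t a b);
  mten_dense : closed_span [set t a b | a in setT & b in setT] = setT;
  mten_spatial : exists (H K HK : hilbertType R) (h : H -> K -> HK)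
      (p : A -> H -> H) (q : B -> K -> K) (r : T -> HK -> HK),
    [/\ is_hilbert_tensor h, is_faithful_rep p, is_faithful_rep q,
        is_faithful_rep r
      & forall a b v w, r (t a b) (h v w) = h (p a v) (q b w)]
}.

Record min_tensor (A B : cstarType R) := MinTensor {
  mten_alg :> cstarType R;
  tens : A -> B -> mten_alg;
  tensP : is_min_tensor tens
}.

End CstarNotions.

Arguments tens {R A B} m a b.

Section QuantumGroups.
Variable R : realType.

(* D (x) Q for C*-subalgebras D of A and Q of B: since the minimal tensor
   product is injective, it is the closed span of the d (x) q inside A (x) B. *)
Definition subtens (A B : cstarType R) (T : min_tensor A B)
  (D : set A) (Q : set B) : set T := closed_span [set tens T d q | d in D & q in Q].

Arguments subtens {A B} T D Q.

(* (alpha (x) id) alpha = (id (x) Delta) alpha on D, for alpha : D -> D (x) Q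
   and Delta : Q -> Q (x) Q; both sides are compared in (B (x) A) (x) A by the
   canonical map assoc from B (x) (A (x) A). *)
Definition coaction_identity (B A : cstarType R) (AA : min_tensor A A)
    (Delta : A -> AA) (BA : min_tensor B A) (D : set B) (Q : set A)
    (alpha : B -> BA) : Prop :=
  exists (L : min_tensor BA A) (M : min_tensor B AA)
      (assoc : M -> L) (alpha_id : BA -> L) (id_Delta : BA -> M),
    [/\ star_hom assoc
          /\ (forall b a a', assoc (tens M b (tens AA a a')) =
                tens L (tens BA b a) a'),
        star_hom_on (subtens BA D Q) alpha_id
          /\ (forall d q, D d -> Q q ->
                alpha_id (tens BA d q) = tens L (alpha d) q),
        star_hom_on (subtens BA D Q) id_Delta
          /\ (forall d q, D d -> Q q ->
                id_Delta (tens BA d q) = tens M d (Delta q))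
      & forall d, D d -> alpha_id (alpha d) = assoc (id_Delta (alpha d))].

Record is_compact_quantum_group (A : cstarType R) (AA : min_tensor A A)
    (Delta : A -> AA) : Prop := {
  cqg_hom : star_hom Delta;
  cqg_coassoc : coaction_identity Delta setT setT Delta;
  cqg_dense_r : closed_span
    [set Delta a ** tens AA cone b | a in setT & b in setT] = setT;
  cqg_dense_l : closed_span
    [set Delta a ** tens AA b cone | a in setT & b in setT] = setT
}.

Record compact_quantum_group := CompactQuantumGroup {
  cqg_alg :> cstarType R;
  cqg_tens : min_tensor cqg_alg cqg_alg;
  comul : cqg_alg -> cqg_tens;
  cqgP : is_compact_quantum_group comul
}.

Record is_quotient_group (G : compact_quantum_group) (Q : set G) : Prop := {
  cqq_sub : cstar_subalgebra Q;
  cqq_comul : forall a, Q a -> subtens (cqg_tens G) Q Q (comul a);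
  cqq_dense_r : closed_span
    [set comul a ** tens (cqg_tens G) cone b | a in Q & b in Q] =
    subtens (cqg_tens G) Q Q;
  cqq_dense_l : closed_span
    [set comul a ** tens (cqg_tens G) b cone | a in Q & b in Q] =
    subtens (cqg_tens G) Q Q
}.

(* The restriction of alpha to the C*-subalgebra D of B is an action on D of
   the quotient group Q of G (of G itself when Q is setT, and on B itself when
   D is setT); only the values of alpha on D matter. *)
Record is_action (G : compact_quantum_group) (Q : set G) (B : cstarType R)
    (D : set B) (BG : min_tensor B G) (alpha : B -> BG) : Prop := {
  act_sub : cstar_subalgebra D;
  act_into : forall d, D d -> subtens BG D Q (alpha d);
  act_hom : star_hom_on D alpha;
  act_coaction : coaction_identity (@comul G) D Q alpha;
  act_dense : closed_span
    [set alpha d ** tens BG cone q | d in D & q in Q] = subtens BG D Q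
}.

(* Faithfulness of the action of G on D given by the restriction of alpha. *)
Definition faithful (G : compact_quantum_group) (B : cstarType R) (D : set B)
    (BG : min_tensor B G) (alpha : B -> BG) : Prop :=
  ~ exists Q : set G, [/\ is_quotient_group Q, Q <> setT
      & exists2 alphaq : B -> BG, is_action Q D alphaq
          & forall d, D d -> alpha d = alphaq d].

Definition magic_unitary (n : nat) (A : cstarType R) (a : 'I_n -> 'I_n -> A) :
    Prop :=
  [/\ (forall i j, star (a i j) = a i j),
      (forall i j, a i j ** a i j = a i j),
      (forall j, \sum_i a i j = cone)
    & (forall i, \sum_j a i j = cone)].

Record is_quantum_permutation_group (n : nat) (G : compact_quantum_group)
    (a : 'I_n -> 'I_n -> G) : Prop := {
  qperm_magic : magic_unitary a;
  qperm_gen : forall S : set G,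
    cstar_subalgebra S -> (forall i j, S (a i j)) -> S = setT;
  qperm_univ : forall (B : cstarType R) (b : 'I_n -> 'I_n -> B),
    magic_unitary b ->
    exists2 f : G -> B, star_hom f & forall i j, f (a i j) = b i j;
  qperm_comul : forall i j,
    comul (a i j) = \sum_k tens (cqg_tens G) (a i k) (a k j)
}.

End QuantumGroups.

Arguments subtens {R A B} T D Q.

HB.mixin Record isCompactHausdorff X of Topological X := {
  compactT : compact [set: X];
  hausdorffT : hausdorff_space X
}.

#[short(type="compactHausdorffType")]
HB.structure Definition CompactHausdorff :=
  {X of isCompactHausdorff X & Topological X}.

Section CompactHausdorffInstances.

Lemma compact_ordinal n : compact [set: discrete_topology 'I_n].
Proof. by apply: finite_compact; exact: (@finite_finset 'I_n). Qed.

HB.instance Definition _ n := isCompactHausdorff.Build (discrete_topology 'I_n)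
  (@compact_ordinal n) discrete_hausdorff.

Variables X Y : compactHausdorffType.

Lemma compact_prod : compact [set: X * Y].
Proof. by rewrite -setXTT; apply: compact_setX; exact: compactT. Qed.

Lemma hausdorff_prod : hausdorff_space (X * Y)%type.
Proof.
move=> [x y] [x' y'] xy; congr pair.
  apply: hausdorffT => A B xA x'B; have := xy (A `*` setT) (B `*` setT).
  case; [by exists (A, setT) => //; split=> //; exact: filterT
    |by exists (B, setT) => //; split=> //; exact: filterT|].
  by move=> [u v] [[/= ? _] [/= ? _]]; exists u.
apply: hausdorffT => A B xA x'B; have := xy (setT `*` A) (setT `*` B).
case; [by exists (setT, A) => //; split=> //; exact: filterT
  |by exists (setT, B) => //; split=> //; exact: filterT|].
by move=> [u v] [[/= _ ?] [/= _ ?]]; exists v.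
Qed.

HB.instance Definition _ := isCompactHausdorff.Build (X * Y)%type
  compact_prod hausdorff_prod.

End CompactHausdorffInstances.

(* C(X), with values in R[i]^o, the type of complex numbers carrying the
   topology of its norm. *)
Definition cfun (R : realType) (X : compactHausdorffType) : Type :=
  continuousType X (R[i])^o.

HB.instance Definition _ (R : realType) (X : compactHausdorffType) :=
  Choice.on (cfun R X).

Section ContinuousFunctions.
Variables (R : realType) (X : compactHausdorffType).
Implicit Types (f g h : cfun R X).

Definition ev f (x : X) : R[i] := (f : continuousType X (R[i])^o) x.

Lemma cfunP f g : (forall x, ev f x = ev g x) -> f = g.
Proof. by move=> fg; apply/continuousEP => x; exact: fg. Qed.

Lemma ev_continuous f : continuous (ev f : X -> (R[i])^o).
Proof. exact: cts_fun. Qed.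

Lemma ev_dist f x e : 0 < e -> \forall y \near x, `|ev f x - ev f y| < e.
Proof.
move=> e0; have := @ev_continuous f x.
by move=> /(@cvgrPdist_lt _ (R[i])^o); exact.
Qed.

Definition mkcfun (u : X -> (R[i])^o) (cu : continuous u) : cfun R X :=
  (mkcts cu : continuousType X (R[i])^o).

Lemma evE u (cu : continuous u) x : ev (mkcfun cu) x = u x. Proof. by []. Qed.

Lemma cadd_subproof f g : continuous ((fun x => ev f x + ev g x) : X -> (R[i])^o).
Proof. by move=> x; apply: cvgD; exact: ev_continuous. Qed.

Lemma copp_subproof f : continuous ((fun x => - ev f x) : X -> (R[i])^o).
Proof. by move=> x; apply: cvgN; exact: ev_continuous. Qed.

Lemma cmul_subproof f g : continuous ((fun x => ev f x * ev g x) : X -> (R[i])^o).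
Proof. by move=> x; apply: (@cvgZ _ (R[i])^o); exact: ev_continuous. Qed.

Lemma cst_subproof (c : R[i]) : continuous ((fun=> c) : X -> (R[i])^o).
Proof. by move=> x; exact: cvg_cst. Qed.

Lemma cconj_subproof f : continuous ((fun x => (ev f x)^*) : X -> (R[i])^o).
Proof.
move=> x; apply/(@cvgrPdist_lt _ (R[i])^o) => e e0.
by apply: filterS (ev_dist f x e0) => y; rewrite -rmorphB normcJ.
Qed.

Definition cfun_add f g := mkcfun (@cadd_subproof f g).
Definition cfun_opp f := mkcfun (@copp_subproof f).
Definition cfun_mul f g := mkcfun (@cmul_subproof f g).
Definition cfun_cst c := mkcfun (@cst_subproof c).
Definition cfun_conj f := mkcfun (@cconj_subproof f).

Lemma cfun_addA : associative cfun_add.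
Proof. by move=> f g h; apply: cfunP => x; rewrite !evE addrA. Qed.
Lemma cfun_addC : commutative cfun_add.
Proof. by move=> f g; apply: cfunP => x; rewrite !evE addrC. Qed.
Lemma cfun_add0 : left_id (cfun_cst 0) cfun_add.
Proof. by move=> f; apply: cfunP => x; rewrite !evE add0r. Qed.
Lemma cfun_addN : left_inverse (cfun_cst 0) cfun_opp cfun_add.
Proof. by move=> f; apply: cfunP => x; rewrite !evE addNr. Qed.

HB.instance Definition _ := GRing.isZmodule.Build (cfun R X)
  cfun_addA cfun_addC cfun_add0 cfun_addN.

Definition cfun_scale (c : R[i]) f := cfun_mul (cfun_cst c) f.

Lemma cfun_scaleA c d f :
  cfun_scale c (cfun_scale d f) = cfun_scale (c * d) f.
Proof. by apply: cfunP => x; rewrite !evE mulrA. Qed.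
Lemma cfun_scale1 : left_id 1 cfun_scale.
Proof. by move=> f; apply: cfunP => x; rewrite !evE mul1r. Qed.
Lemma cfun_scaleDr : right_distributive cfun_scale +%R.
Proof. by move=> c f g; apply: cfunP => x; rewrite !evE mulrDr. Qed.
Lemma cfun_scaleDl f : {morph cfun_scale^~ f : c d / c + d}.
Proof. by move=> c d; apply: cfunP => x; rewrite !evE mulrDl. Qed.

HB.instance Definition _ := GRing.Zmodule_isLmodule.Build R[i] (cfun R X)
  cfun_scaleA cfun_scale1 cfun_scaleDr cfun_scaleDl.

Lemma evD f g x : ev (f + g) x = ev f x + ev g x. Proof. by []. Qed.
Lemma evN f x : ev (- f) x = - ev f x. Proof. by []. Qed.
Lemma evB f g x : ev (f - g) x = ev f x - ev g x. Proof. by []. Qed.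
Lemma evZ c f x : ev (c *: f) x = c * ev f x. Proof. by []. Qed.
Lemma ev0 x : ev 0 x = 0. Proof. by []. Qed.

Definition cfun_norm f : R[i] := (sup [set complex.Re `|ev f x| | x in setT])%:C.

Lemma cnormE (z : R[i]) : `|z| = (complex.Re `|z|)%:C.
Proof. by rewrite RRe_real// normr_real. Qed.

Lemma Re_norm_ge0 (z : R[i]) : 0 <= complex.Re `|z|.
Proof. by rewrite -lecR -cnormE normr_ge0. Qed.

Lemma cfun_has_ubound f : has_ubound [set complex.Re `|ev f x| | x in setT].
Proof.
have cn : continuous (fun x => complex.Re `|ev f x|).
  move=> x; apply/cvgrPdist_lt => e e0.
  have e0' : 0 < e%:C by rewrite ltcR.
  apply: filterS (ev_dist f x e0') => y fxy.
  rewrite -ltcR; apply: le_lt_trans fxy.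
  have cr : ((`|complex.Re `|ev f x| - complex.Re `|ev f y| |)%:C =
     `| `|ev f x| - `|ev f y| |).
    rewrite [`|ev f x|]cnormE [`|ev f y|]cnormE /= -rmorphB.
    by rewrite [RHS]normc_def/= expr0n/= addr0 sqrtr_sqr.
  by rewrite cr; exact: ler_dist_dist.
have cpt : compact [set complex.Re `|ev f x| | x in setT].
  by apply: continuous_compact; [exact: continuous_subspaceT|exact: compactT].
have [M [_ /(_ (M + 1))]] := compact_bounded cpt.
rewrite ltrDl ltr01 => /(_ isT) bM; exists (M + 1) => r /bM /=.
by apply: le_trans; exact: ler_norm.
Qed.

Lemma le_cfun_norm f x : `|ev f x| <= cfun_norm f.
Proof.
rewrite cnormE /cfun_norm lecR; apply: ub_le_sup; last by exists x.
exact: cfun_has_ubound.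
Qed.

Lemma cfun_norm_le f (M : R[i]) :
  0 <= M -> (forall x, `|ev f x| <= M) -> cfun_norm f <= M.
Proof.
move=> M0 fM; have ME : (complex.Re M)%:C = M by rewrite RRe_real// ger0_real.
rewrite /cfun_norm -ME lecR.
have [->|/set0P ne] := eqVneq [set complex.Re `|ev f x| | x in setT] set0.
  by rewrite sup0 -lecR ME.
by apply: ge_sup => // _ [x _ <-]; rewrite -lecR ME -cnormE.
Qed.

Lemma cfun_norm_ge0 f : 0 <= cfun_norm f.
Proof.
rewrite /cfun_norm lecR.
have [->|/set0P [r [x xT rE]]] :=
  eqVneq [set complex.Re `|ev f x| | x in setT] set0; first by rewrite sup0.
apply: le_trans (Re_norm_ge0 (ev f x)) _.
by apply: ub_le_sup; [exact: cfun_has_ubound|exists x].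
Qed.

Lemma cfun_normD f g : cfun_norm (f + g) <= cfun_norm f + cfun_norm g.
Proof.
apply: cfun_norm_le; first by rewrite addr_ge0 ?cfun_norm_ge0.
by move=> x; rewrite evD (le_trans (ler_normD _ _))// lerD// le_cfun_norm.
Qed.

Lemma cfun_norm_eq0 f : cfun_norm f = 0 -> f = 0.
Proof.
move=> f0; apply: cfunP => x; apply/normr0_eq0/le_anti.
by rewrite normr_ge0 andbT -f0 le_cfun_norm.
Qed.

Lemma cfun_normZ c f : cfun_norm (c *: f) = `|c| * cfun_norm f.
Proof.
apply: le_anti; apply/andP; split.
  apply: cfun_norm_le; first by rewrite mulr_ge0 ?cfun_norm_ge0.
  by move=> x; rewrite evZ normrM ler_wpM2l// le_cfun_norm.
have [->|c0] := eqVneq c 0; first by rewrite normr0 mul0r cfun_norm_ge0.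
rewrite -ler_pdivlMl ?normr_gt0//; apply: cfun_norm_le => [|x].
  by rewrite mulr_ge0 ?invr_ge0 ?cfun_norm_ge0.
by rewrite ler_pdivlMl ?normr_gt0// -normrM -evZ le_cfun_norm.
Qed.

HB.instance Definition _ := Lmodule_isNormed.Build R[i] (cfun R X)
  cfun_normD cfun_normZ cfun_norm_eq0.

Lemma cfun_normE f : `|f| = cfun_norm f. Proof. by []. Qed.

Lemma Re_le_norm (z : R[i]) : `|complex.Re z|%:C <= `|z|.
Proof. exact: normc_ge_Re. Qed.

Lemma Im_le_norm (z : R[i]) : `|complex.Im z|%:C <= `|z|.
Proof.
rewrite normc_def lecR -[leLHS]sqrtr_sqr ler_wsqrtr//.
by rewrite lerDr sqr_ge0.
Qed.

Lemma norm_le_ReIm (z : R[i]) :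
  `|z| <= (`|complex.Re z| + `|complex.Im z|)%:C.
Proof.
case: z => a b; rewrite normc_def lecR /=.
rewrite -[leRHS]ger0_norm ?addr_ge0// -[leRHS]sqrtr_sqr ler_wsqrtr//.
rewrite sqrrD !real_normK ?num_real// lerD2r lerDl.
by rewrite mulrn_wge0// mulr_ge0.
Qed.

Lemma complex_complete (F : set_system (R[i])^o) :
  ProperFilter F -> cauchy F -> cvg F.
Proof.
move=> FF Fc.
have cR (p : R[i] -> R) : {morph p : x y / x - y} ->
    (forall z, `|p z|%:C <= `|z|) -> cvg (p @ F).
  move=> pB pn; apply/cauchy_cvgP/cauchy_ballP => e e0.
  have e0' : 0 < e%:C by rewrite ltcR.
  have /cauchy_ballP /(_ _ e0') [[A B] /= [FA FB] AB] := Fc.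
  exists (p @` A, p @` B) => /=.
    by split; [apply: filterS FA|apply: filterS FB] => z Az; exists z.
  move=> [_ _] [/= [z Az <-] [w Bw <-]].
  have := AB (z, w) (conj Az Bw); rewrite -!ball_normE /=.
  by rewrite -pB -ltcR; exact/le_lt_trans.
have /cvg_ex[a Fa] : cvg (@complex.Re R @ F).
  by apply: cR; [move=> [? ?] [? ?]|exact: Re_le_norm].
have /cvg_ex[b Fb] : cvg (@complex.Im R @ F).
  by apply: cR; [move=> [? ?] [? ?]|exact: Im_le_norm].
apply/cvg_ex; exists (a +i* b); apply/(@cvgrPdist_lt _ (R[i])^o) => e e0.
have eE : (complex.Re e)%:C = e by rewrite RRe_real// gtr0_real.
have r0 : 0 < complex.Re e / 2 by rewrite divr_gt0// -ltcR eE.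
move/cvgrPdist_lt : Fa => /(_ _ r0) Fa; move/cvgrPdist_lt : Fb => /(_ _ r0) Fb.
apply: filterS2 Fa Fb => -[u v] /= ua vb.
apply: le_lt_trans (norm_le_ReIm _) _; rewrite -eE ltcR.
by rewrite [ltRHS]splitr ltrD.
Qed.

Lemma cfun_complete (F : set_system (cfun R X)) :
  ProperFilter F -> cauchy F -> cvg F.
Proof.
move=> FF Fc.
have Fe (e : R[i]) : 0 < e ->
    \forall f \near F, \forall g \near F, `|f - g| < e.
  move=> e0; have /cauchy_ballP /(_ _ e0) [[A B] /= [FA FB] AB] := Fc.
  apply: filterS FA => f Af; apply: filterS FB => g Bg.
  by have := AB (f, g) (conj Af Bg); rewrite -ball_normE.
have cx x : cvg ((fun f => ev f x : (R[i])^o) @ F).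
  apply: complex_complete; apply/cauchy_ballP => e e0.
  have /cauchy_ballP /(_ _ e0) [[A B] /= [FA FB] AB] := Fc.
  exists ((ev^~ x) @` A, (ev^~ x) @` B) => /=.
    by split; [apply: filterS FA|apply: filterS FB] => z Az; exists z.
  move=> [_ _] [/= [z Az <-] [w Bw <-]].
  have := AB (z, w) (conj Az Bw); rewrite -!ball_normE /= -evB.
  exact/le_lt_trans/le_cfun_norm.
pose l x : (R[i])^o := lim ((fun f => ev f x : (R[i])^o) @ F).
have Fl (e : R[i]) : 0 < e -> \forall f \near F, forall x, `|l x - ev f x| < e.
  move=> e0; have e20 : 0 < e / 2 by rewrite divr_gt0.
  apply: filterS (Fe _ e20) => f Ff x.
  have /(@cvgrPdist_lt _ (R[i])^o) /(_ _ e20) lx := cx x.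
  have [g [lg fg]] := filter_ex (filterI lx Ff).
  have gf : `|ev g x - ev f x| < e / 2.
    by rewrite distrC -evB; exact: le_lt_trans (le_cfun_norm _ _) fg.
  rewrite -(subrK (ev g x) (l x)) -addrA; apply: le_lt_trans (ler_normD _ _) _.
  by rewrite [ltRHS]splitr; exact: ltrD.
have cl : continuous l.
  move=> x; apply/(@cvgrPdist_lt _ (R[i])^o) => e e0.
  have e30 : 0 < e / 3 by rewrite divr_gt0.
  have [f lf] := filter_ex (Fl _ e30).
  apply: filterS (ev_dist f x e30) => y fxy.
  have -> : l x - l y = (l x - ev f x) + ((ev f x - ev f y) + (ev f y - l y)).
    by rewrite !addrA !subrK.
  have -> : e = e / 3 + (e / 3 + e / 3).
    by change (e = e / 3 *+ 3); rewrite -[RHS]mulr_natr divfK ?pnatr_eq0.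
  apply: le_lt_trans (ler_normD _ _) _; apply: ltrD; first exact: lf.
  apply: le_lt_trans (ler_normD _ _) _; apply: ltrD; first exact: fxy.
  by rewrite distrC; exact: lf.
apply/cvg_ex; exists (mkcfun cl); apply/cvgrPdist_lt => e e0.
have e20 : 0 < e / 2 by rewrite divr_gt0.
apply: filterS (Fl _ e20) => f lf.
apply: (@le_lt_trans _ _ (e / 2)); last first.
  by rewrite gtr_pMr// invf_lt1 ?ltr1n.
apply: cfun_norm_le; first exact: ltW.
by move=> x; rewrite evB ltW.
Qed.

HB.instance Definition _ := Uniform_isComplete.Build (cfun R X) cfun_complete.

Lemma cfun_mulA : associative cfun_mul.
Proof. by move=> f g h; apply: cfunP => x; rewrite !evE mulrA. Qed.
Lemma cfun_mul1 : left_id (cfun_cst 1) cfun_mul.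
Proof. by move=> f; apply: cfunP => x; rewrite !evE mul1r. Qed.
Lemma cfun_mulr1 : right_id (cfun_cst 1) cfun_mul.
Proof. by move=> f; apply: cfunP => x; rewrite !evE mulr1. Qed.
Lemma cfun_mulDl : left_distributive cfun_mul +%R.
Proof. by move=> f g h; apply: cfunP => x; rewrite !(evE, evD) mulrDl. Qed.
Lemma cfun_mulDr : right_distributive cfun_mul +%R.
Proof. by move=> f g h; apply: cfunP => x; rewrite !(evE, evD) mulrDr. Qed.
Lemma cfun_mulZl c f g : cfun_mul (c *: f) g = c *: cfun_mul f g.
Proof. by apply: cfunP => x; rewrite !(evE, evZ) mulrA. Qed.
Lemma cfun_mulZr c f g : cfun_mul f (c *: g) = c *: cfun_mul f g.
Proof. by apply: cfunP => x; rewrite !(evE, evZ) mulrCA. Qed.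
Lemma cfun_conjD : {morph cfun_conj : f g / f + g}.
Proof. by move=> f g; apply: cfunP => x; rewrite !(evE, evD) rmorphD. Qed.
Lemma cfun_conjZ c f : cfun_conj (c *: f) = c^* *: cfun_conj f.
Proof. by apply: cfunP => x; rewrite !(evE, evZ) rmorphM. Qed.
Lemma cfun_conjM f g :
  cfun_conj (cfun_mul f g) = cfun_mul (cfun_conj g) (cfun_conj f).
Proof. by apply: cfunP => x; rewrite !evE rmorphM mulrC. Qed.
Lemma cfun_conjK : involutive cfun_conj.
Proof. by move=> f; apply: cfunP => x; rewrite !evE conjcK. Qed.
Lemma cfun_normM f g : `|cfun_mul f g| <= `|f| * `|g|.
Proof.
apply: cfun_norm_le => [|x]; first by rewrite mulr_ge0.
by rewrite evE normrM ler_pM// le_cfun_norm.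
Qed.
Lemma cfun_norm_conj f : `|cfun_mul (cfun_conj f) f| = `|f| ^+ 2.
Proof.
apply: le_anti; apply/andP; split.
  apply: cfun_norm_le => [|x]; first by rewrite exprn_ge0.
  by rewrite !evE normrM normcJ -expr2 lerXn2r ?nnegrE// le_cfun_norm.
set N := `|cfun_mul _ _|; have N0 : 0 <= N by rewrite normr_ge0.
rewrite -[N]sqrtCK lerXn2r ?nnegrE ?sqrtC_ge0//.
apply: cfun_norm_le => [|x]; first by rewrite sqrtC_ge0.
rewrite -(@ler_pXn2r _ 2) ?nnegrE ?sqrtC_ge0// sqrtCK.
apply: le_trans (le_cfun_norm (cfun_mul (cfun_conj f) f) x).
by rewrite !evE normrM normcJ expr2.
Qed.

HB.instance Definition _ := isCstarAlgebra.Build R (cfun R X)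
  cfun_mulA cfun_mul1 cfun_mulr1 cfun_mulDl cfun_mulDr cfun_mulZl cfun_mulZr
  cfun_conjD cfun_conjZ cfun_conjM cfun_conjK cfun_normM cfun_norm_conj.

End ContinuousFunctions.

Section GluedCopies.
Variables (R : realType) (n : nat) (Y : compactHausdorffType).

Notation Xn := (discrete_topology 'I_n).

Lemma delta_subproof (i : 'I_n) :
  continuous ((fun j => (j == i)%:R) : Xn -> (R[i])^o).
Proof.
move=> j U Uj; apply: (@filterS _ (nbhs j) _ [set j]).
  by move=> _ /= ->; exact: nbhs_singleton Uj.
exact: (@discrete_set1 Xn).
Qed.

Definition delta (i : 'I_n) : cfun R Xn := mkcfun (@delta_subproof i).

Lemma ftens_subproof (g : cfun R Xn) (f : cfun R Y) :
  continuous ((fun p => ev g p.1 * ev f p.2) : Xn * Y -> (R[i])^o).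
Proof.
move=> p; apply: (@cvgZ _ (R[i])^o).
  by apply: (@cvg_comp _ _ _ fst); [exact: cvg_fst|exact: ev_continuous].
by apply: (@cvg_comp _ _ _ snd); [exact: cvg_snd|exact: ev_continuous].
Qed.

(* The identification of C(X_n) (x) C(Y) with C(X_n x Y). *)
Definition ftens (g : cfun R Xn) (f : cfun R Y) : cfun R (Xn * Y)%type :=
  mkcfun (@ftens_subproof g f).

Definition glue_rel (Y1 : set Y) (p q : Xn * Y) : Prop :=
  (p.2 = q.2 /\ Y1 p.2) \/ (p.2 = q.2 /\ p.1 = q.1).

(* C((X_n x Y)/~) as a C*-subalgebra of C(X_n x Y). *)
Definition glued_cfun (Y1 : set Y) : set (cfun R (Xn * Y)%type) :=
  [set F | forall p q, glue_rel Y1 p q -> ev F p = ev F q].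

End GluedCopies.

(* Main.v *)
From HB Require Import structures.
Require Import Defs.
From mathcomp Require Import all_boot all_order all_algebra.
From mathcomp Require Import all_classical all_reals all_analysis.
From mathcomp.real_closed Require Import complex.
Set Implicit Arguments. Unset Strict Implicit. Unset Printing Implicit Defensive.
Import Order.TTheory GRing.Theory Num.Theory.
Import numFieldNormedType.Exports.
Local Open Scope classical_set_scope.
Local Open Scope ring_scope.

(** Suppose the restriction of alpha to the glued functions takes values in
    D (x) Q, for D = C((X_n x Y)/~) and Q a quotient group. It suffices to show
    that Q contains every generator a_ki, since Q is a C*-subalgebra.

    Choose y0 outside Y1 and, by Urysohn, f in C(Y) with f(y0) = 1 that
    vanishes on Y1. Then e_i (x) f vanishes wherever points are glued, so it
    belongs to D, and
      alpha(e_i (x) f) = sum_j (e_j (x) f) (x) a_ji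
    lies in D (x) Q. Applying the slice map (evaluation at (x_k, y0)) (x) id
    yields a_ki on the left; on the right, it sends d (x) q to d(x_k, y0) q,
    hence D (x) Q into the closed subspace Q ([slice_subtens]).

    What has to be established is that slicing C(X) (x) A -> A at a point x is
    contractive for the spatial norm ([slice_contraction]). Represent C(X) on H
    and A on K. Evaluation at x need not be a vector state on H, but it is a
    limit of such: bump functions concentrated near x produce vectors of H on
    which finitely many given c_i act almost as the scalars c_i(x)
    ([approx_eigenvector]). On v (x) w, with v such a vector, the operator
    sum_i c_i (x) b_i is close to v (x) (sum_i c_i(x) b_i) w, which bounds the
    norm of sum_i c_i(x) b_i. *)

(** The representations and tensor maps at hand are only known to satisfy the
    predicate [linear]; these three lemmas supply the rules that
    otherwise require a bundled linear map. *)
Lemma linear_sum_of (K : pzRingType) (V W : lmodType K) (f : V -> W) :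
  linear f -> forall (I : finType) (v : I -> V),
  f (\sum_i v i) = \sum_i f (v i).
Proof.
move=> fl I v.
pose F : {linear V -> W} := HB.pack f (GRing.isLinear.Build K V W *:%R f fl).
exact: (linear_sum F).
Qed.

Lemma linear_scale_of (K : pzRingType) (V W : lmodType K) (f : V -> W) :
  linear f -> forall c v, f (c *: v) = c *: f v.
Proof.
move=> fl c v.
pose F : {linear V -> W} := HB.pack f (GRing.isLinear.Build K V W *:%R f fl).
exact: (linearZZ F).
Qed.

Lemma linear_sub_of (K : pzRingType) (V W : lmodType K) (f : V -> W) :
  linear f -> forall u v, f (u - v) = f u - f v.
Proof.
move=> fl u v.
pose F : {linear V -> W} := HB.pack f (GRing.isLinear.Build K V W *:%R f fl).
exact: (linearB F).
Qed.

Lemma cfun_bump (R : realType) (X : compactHausdorffType) (x : X) (B : set X) :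
  closed B -> ~ B x ->
  exists g : cfun R X,
    [/\ ev g x = 1, (forall y, `|ev g y| <= 1) & forall y, B y -> ev g y = 0].
Proof.
move=> Bc Bx.
have nX : normal_space X.
  by apply: compact_normal; [exact: hausdorffT|exact: compactT].
have aX : accessible_space X by apply: hausdorff_accessible; exact: hausdorffT.
have /(@uniform_separatorP _ R)[f [fc f01 fx fB]] :=
  @normal_completely_regular R X nX aX _ _ Bc Bx.
(* The separating function f is 0 at x and 1 on B. *)
have gc : continuous ((fun y => (1 - f y)%:C%C) : X -> (R[i])^o).
  move=> y; apply/(@cvgrPdist_lt _ (R[i])^o) => e e0.
  have eE : ((complex.Re e)%:C)%C = e by rewrite RRe_real// gtr0_real.
  have e0' : 0 < complex.Re e by rewrite -ltcR eE.
  have /cvgrPdist_lt/(_ _ e0') := fc y.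
  apply: filterS => z fyz; rewrite -rmorphB/= opprD opprK addrACA subrr add0r.
  rewrite normc_def/= expr0n/= addr0 sqrtr_sqr -eE ltcR.
  by rewrite addrC distrC.
have fE y : 0 <= f y <= 1.
  by have := f01 (f y) (ex_intro2 _ _ y I erefl); rewrite /= in_itv.
exists (mkcfun gc); split => [|y|y By]; rewrite evE.
- by rewrite (fx (f x)) ?subr0//; exists x.
- have /andP[f0 f1] := fE y.
  rewrite normc_def/= expr0n/= addr0 sqrtr_sqr lecR.
  by rewrite ger0_norm ?subr_ge0// gerBl.
- by rewrite (fB (f y)) ?subrr//; exists y.
Qed.

Lemma norm_hten (R : realType) (H K HK : hilbertType R) (h : H -> K -> HK)
    v w :
  is_hilbert_tensor h -> `|h v w| = `|v| * `|w|.
Proof.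
move=> hP; apply/eqP; rewrite -(@eqrXn2 _ 2) ?mulr_ge0//.
by rewrite exprMn -!dot_norm hten_dot.
Qed.

Section Slice.
Variables (R : realType) (X : compactHausdorffType).

(** If g is a bump at x supported where every c_i is within e/2 of c_i(x), then
    (c_i - c_i(x)) g has norm at most e/2. As g has norm 1 in the isometric
    representation p, some w satisfies |p g w| > |w|/2; the vector p g w then
    works for all i simultaneously. *)
Lemma approx_eigenvector (H : hilbertType R) (p : cfun R X -> H -> H)
    (x : X) (I : finType) (c : I -> cfun R X) (e : R[i]) :
  is_faithful_rep p -> 0 < e ->
  exists2 v, 0 < `|v| &
    forall i, `|p (c i) v - ev (c i) x *: v| <= e * `|v|.
Proof.
move=> pP e0; have e20 : 0 < e / 2 by rewrite divr_gt0.
pose U := [set y | forall i, `|ev (c i) x - ev (c i) y| < e / 2].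
have Ux : nbhs x U.
  by apply: filter_forall => i; exact: ev_dist.
have [||g [gx g1 gU]] := @cfun_bump R X x (~` U°).
- exact/open_closedC/open_interior.
- by apply.
have ng : 1 <= `|g| by rewrite -(normr1 R[i]) -gx; exact: le_cfun_norm.
have [w vw] : exists w, `|w| / 2 < `|p g w|.
  apply: contrapT => /forallNP nw.
  have [_ _ /(_ 2^-1)] := rep_norm pP g.
  rewrite invr_ge0 ler0n => /(_ isT) gle.
  suff : 1 <= 2^-1 :> R[i].
    by rewrite invf_ge1 ?ltr0n// (ler_nat _ 2 1).
  apply: le_trans ng (gle _) => w; rewrite mulrC.
  have := nw w => /negP; rewrite -real_leNgt ?ger0_real ?divr_ge0//.
exists (p g w) => [|i]; first by apply: le_lt_trans vw; rewrite divr_ge0.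
have -> : p (c i) (p g w) - ev (c i) x *: p g w =
    p (((c i - ev (c i) x *: cone) : cfun R X) ** g) w.
  rewrite repM// (linear_sub_of (rep_lin pP (p g w))).
  by rewrite (linear_scale_of (rep_lin pP (p g w))) rep1.
have [_ /(_ w) + _] := rep_norm pP (((c i - ev (c i) x *: cone) : cfun R X) ** g).
move/le_trans; apply.
apply: (@le_trans _ _ (e / 2 * `|w|)).
  rewrite ler_wpM2r//; apply: cfun_norm_le => [|y]; first exact: ltW.
  rewrite evE normrM.
  have [/interior_subset /(_ i) Uy|nU] := pselect (U° y).
    rewrite -[e / 2]mulr1 ler_pM//.
    by rewrite evD evN evZ evE mulr1 distrC ltW.
  by rewrite gU// normr0 mulr0 ltW.
by rewrite -mulrA ler_pM2l// mulrC ltW.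
Qed.

Variables (A : cstarType R) (T : min_tensor (cfun R X) A).

(** The operator r z is tested only on elementary vectors h v w, where v is an
    approximate common eigenvector of the c_i; this is enough because the norm
    of sum_i c_i(x) b_i is computed on K alone. *)
Lemma slice_contraction (x : X) (I : finType) (c : I -> cfun R X) (b : I -> A) :
  `|\sum_i ev (c i) x *: b i| <= `|\sum_i tens T (c i) (b i)|.
Proof.
have [H [K [HK [h [p [q [r [hP pP qP rP rt]]]]]]]] := mten_spatial (tensP T).
apply/ler_addgt0Pr => d d0; set z := \sum_i tens _ _ _; set s := \sum_i _.
pose C := \sum_i `|b i|; have C0 : 0 <= C by exact: sumr_ge0.
(* With this tolerance the total error is at most d C / (C + 1) <= d. *)
have e0 : 0 < d / (C + 1) by rewrite divr_gt0// ltr_wpDl.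
have [v v0 cv] := approx_eigenvector x c pP e0.
have [_ _] := rep_norm qP s; apply => [|w]; first by rewrite addr_ge0// ltW.
have -> : q s w = \sum_i ev (c i) x *: q (b i) w.
  rewrite (linear_sum_of (rep_lin qP w)); apply: eq_bigr => i _.
  exact: (linear_scale_of (rep_lin qP w)).
set S := \sum_i _.
have zE : h v S =
    r z (h v w) - \sum_i h (p (c i) v - ev (c i) x *: v) (q (b i) w).
  rewrite (linear_sum_of (rep_lin rP (h v w))) -sumrB.
  rewrite (linear_sum_of (hten_linr hP v)); apply: eq_bigr => i _.
  rewrite rt (linear_sub_of (hten_linl hP _)) opprB addrC subrK.
  rewrite (linear_scale_of (hten_linl hP _)).
  exact: (linear_scale_of (hten_linr hP v)).
rewrite -(ler_pM2l v0) -(norm_hten _ _ hP) zE.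
apply: le_trans (ler_normB _ _) _; rewrite mulrDl mulrDr; apply: lerD.
  have [_ /(_ (h v w)) + _] := rep_norm rP z.
  by rewrite (norm_hten _ _ hP) mulrCA.
apply: le_trans (ler_norm_sum _ _ _) _.
apply: (@le_trans _ _ (\sum_i (d / (C + 1) * `|v|) * (`|b i| * `|w|))).
  apply: ler_sum => i _; rewrite (norm_hten _ _ hP) ler_pM//.
  by have [_ /(_ w)] := rep_norm qP (b i).
rewrite -mulr_sumr -mulr_suml -/C -mulrA mulrCA ler_pM2l// mulrA.
rewrite ler_wpM2r// mulrAC ler_pdivrMr ?ltr_wpDl//.
by rewrite ler_pM2l// lerDl.
Qed.

(** Since elementary tensor decompositions are not unique, the slice map is never
    introduced as a function; this form of the contraction says that it would be
    well defined and 1-Lipschitz. *)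
Lemma slice_contractionB (x : X) (I J : finType)
    (c : I -> cfun R X) (b : I -> A) (c' : J -> cfun R X) (b' : J -> A) :
  `|\sum_i ev (c i) x *: b i - \sum_j ev (c' j) x *: b' j| <=
  `|\sum_i tens T (c i) (b i) - \sum_j tens T (c' j) (b' j)|.
Proof.
rewrite -!sumrN.
have -> : \sum_j - (ev (c' j) x *: b' j) = \sum_j ev (c' j) x *: - b' j.
  by apply: eq_bigr => j _; rewrite scalerN.
have -> : \sum_j - tens T (c' j) (b' j) = \sum_j tens T (c' j) (- b' j).
  apply: eq_bigr => j _; rewrite -(scaleN1r (b' j)).
  by rewrite (linear_scale_of (mten_linr (tensP T) (c' j))) scaleN1r.
have := @slice_contraction x (I + J)%type
  (fun k => match k with inl i => c i | inr j => c' j end)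
  (fun k => match k with inl i => b i | inr j => - b' j end).
by rewrite !big_sumType.
Qed.

(** Elements of D (x) Q are limits of sums of d (x) q, whose slices lie in Q;
    slicing is contractive and Q is closed. *)
Lemma slice_subtens (x : X) (D : set (cfun R X)) (Q : set A) (I : finType)
    (c : I -> cfun R X) (b : I -> A) :
  cstar_subalgebra Q -> subtens T D Q (\sum_i tens T (c i) (b i)) ->
  Q (\sum_i ev (c i) x *: b i).
Proof.
move=> Qsub zQ; have /closure_id -> := csub_closed Qsub.
move=> N /nbhs_ballP[e /= e0 eN].
have [_ [[m [k [u [uP ->]]]]]] := zQ _ (nbhsx_ballx _ _ e0).
rewrite -ball_normE /= => ze.
have /choice[dq dqP] i :
    exists dq : cfun R X * A, Q dq.2 /\ u i = tens T dq.1 dq.2.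
  by have [d Dd [q Qq <-]] := uP i; exists (d, q).
exists (\sum_i ev (k i *: (dq i).1) x *: (dq i).2); split; last first.
  apply: eN; rewrite -ball_normE /=; apply: le_lt_trans ze.
  apply: le_trans (slice_contractionB _ _ _ _ _) _.
  rewrite le_eqVlt; apply/orP; left; apply/eqP; congr `|_ - _|.
  apply: eq_bigr => i _; have [_ ->] := dqP i.
  exact: (linear_scale_of (mten_linl (tensP T) _)).
have Q0 : Q 0.
  rewrite -(addNr (cone : A)) -scaleN1r.
  exact: (csub_lin Qsub _ (csub1 Qsub) (csub1 Qsub)).
apply: (big_ind Q) => // [y z Qy Qz|i _].
  by rewrite -[y]scale1r; exact: (csub_lin Qsub).
rewrite -[X in Q X]addr0; apply: (csub_lin Qsub) => //.
by case: (dqP i).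
Qed.

End Slice.

Lemma ev_ftens_delta (R : realType) (n : nat) (Y : compactHausdorffType)
    (i : 'I_n) (f : cfun R Y) (p : discrete_topology 'I_n * Y) :
  ev (ftens (delta R i) f) p = (p.1 == i)%:R * ev f p.2.
Proof. by []. Qed.

Theorem theorem3p5 (R : realType) (n : nat) (n_gt0 : (0 < n)%N)
  (Y : compactHausdorffType) (Y1 : set Y) (Y1_closed : closed Y1)
  (A_n : compact_quantum_group R) (a : 'I_n -> 'I_n -> A_n)
  (A_nP : is_quantum_permutation_group a)
  (CA : min_tensor (cfun R (discrete_topology 'I_n * Y)%type) A_n)
  (alpha : cfun R (discrete_topology 'I_n * Y)%type -> CA)
  (alpha_action : is_action setT setT alpha)
  (alphaE : forall (i : 'I_n) (f : cfun R Y),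
    alpha (ftens (delta R i) f) =
    \sum_(k < n) tens CA (ftens (delta R k) f) (a k i)) :
  Y1 <> setT -> faithful (glued_cfun Y1) alpha.
Proof.
move=> Y1T [Q [QP QT [alphaq alphaqP alphaqE]]].
apply: QT; apply: (qperm_gen A_nP) => [|k i]; first exact: cqq_sub QP.
have [y0 Y1y0] : exists y, ~ Y1 y.
  apply: contrapT => /forallNP Y1all; apply: Y1T; apply/seteqP.
  by split=> // y _; exact: contrapT (Y1all y).
have [f [fy0 _ f0]] := cfun_bump R Y1_closed Y1y0.
have fD : glued_cfun Y1 (ftens (delta R i) f).
  move=> p q; rewrite !ev_ftens_delta => -[[<- Yp]|[-> ->]//].
  by rewrite f0// !mulr0.
have := act_into alphaqP fD; rewrite -alphaqE// alphaE.
pose x0 : (discrete_topology 'I_n * Y)%type := (k, y0).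
move/(slice_subtens x0 (cqq_sub QP)).
under eq_bigr do rewrite ev_ftens_delta.
rewrite (bigD1 k)//= big1 => [|j jk].
  by rewrite eqxx fy0 mulr1 scale1r addr0.
by rewrite eq_sym (negPf jk) mul0r scale0r.
Qed.
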